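(* Let $X$ be a forward (respectively backward) complete non-degenerate metric $1$-space. If $F:X\to X$ is a forward (respectively backward) continuous contraction and $\alpha$ is a forward (respectively backward) natural contraction of $F$, then $F$ has an $\alpha$-fixed arrow. In particular, $F$ has a fixed object (an object $d$ with $F(d)=d$).
   Context: $\mathbb{R}_+=[0,\infty)\cup\{\infty\}$. A metric $1$-space is a category $X$ together with a weight $w(\psi)\in\mathbb{R}_+$ for every arrow $\psi$ of $X$ such that $w(id_x)=0$ for every object $x$, and the full triangle inequality $|w(\varphi)-w(\psi)|\le w(\varphi\circ\psi)\le w(\varphi)+w(\psi)$ holds for all composable arrows $\psi:x\to y$, $\varphi:y\to z$. Conventions: $r+\infty=\infty+r=\infty+\infty=\infty$ and $|r-\infty|=|\infty-r|=\infty$ for real $r\ge 0$; if $w(\varphi)=w(\psi)=\infty$ no lower bound on $w(\varphi\circ\psi)$ is imposed. $X$ is non-degenerate if every arrow $\psi$ with $w(\psi)=0$ is an identity arrow. Series. A forward series is a sequence of arrows $\{\psi_n:x_n\to x_{n+1}\}_{n\ge0}$; it converges if there are an object $x_\infty$ and arrows $\mu_n:x_n\to x_\infty$ with $\mu_{n+1}\circ\psi_n=\mu_n$ for all $n$ and $\lim_{n\to\infty}w(\mu_n)=0$. It is Cauchy if for every $\epsilon>0$ there is $N$ such that $w(\psi_n\circ\psi_{n-1}\circ\cdots\circ\psi_m)<\epsilon$ for all $n>m>N$. Dually, a backward series is a sequence $\{\psi_n:x_{n+1}\to x_n\}_{n\ge0}$; it converges if there are $x_\infty$ and arrows $\mu_n:x_\infty\to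 x_n$ with $\psi_n\circ\mu_{n+1}=\mu_n$ for all $n$ and $\lim_{n\to\infty} w(\mu_n)=0$; it is Cauchy if for every $\epsilon>0$ there is $N$ such that $w(\psi_m\circ\psi_{m+1}\circ\cdots\circ\psi_n)<\epsilon$ for all $n>m>N$. $X$ is forward (backward) complete if every forward (backward) Cauchy series converges. A functor $F:X\to Y$ between metric $1$-spaces is forward continuous if for every arrow $\psi:x\to z$ and every $\epsilon>0$ there is $\delta>0$ such that whenever $\psi=\rho\circ\tau$ with $\tau:x\to y$, $\rho:y\to z$ and $w(\rho)<\delta$, then $w(F(\rho))<\epsilon$. It is backward continuous if for every $\psi$ and every $\epsilon>0$ there is $\delta>0$ such that whenever $\psi=\rho\circ\tau$ with $w(\tau)<\delta$, then $w(F(\tau))<\epsilon$. $F:X\to X$ is a contraction if there is a real $0\le\kappa<1$ with $w(F(\psi))\le\kappa\cdot w(\psi)$ for every arrow $\psi$. A forward natural contraction of $F:X\to X$ is a natural transformation $\alpha:id_X\to F$ with $F(\alpha_c)=\alpha_{F(c)}$ for every object $c$; a backward natural contraction is a natural transformation $\alpha:F\to id_X$ with $F(\alpha_c)=\alpha_{F(c)}$ for every object $c$. For a forward natural contraction $\alpha$, an arrow $\psi:c\to d$ is $\alpha$-fixed if $F(d)=d$ and $F(\psi)\circ\alpha_c=\psi$. Dually, for a backward natural contraction $\alpha$, an arrow $\psi:d\to c$ is $\alpha$-fixed if $F(d)=d$ and $\alpha_c\circ F(\psi)=\psi$.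
   Formalization: In each half it is also assumed that some object c has w(α_c) finite (so X is nonempty); without this the claim fails, e.g. for the poset (N,≤) with weight ∞ on all non-identity arrows, F the successor and α_n: n→n+1. *)

(* Defs.v *)
From mathcomp Require Import all_boot all_order all_algebra.
From mathcomp Require Import all_classical all_reals ereal topology normedtype.
From mathcomp Require Import sequences.

Set Implicit Arguments.
Unset Strict Implicit.
Unset Printing Implicit Defensive.

Import Order.TTheory GRing.Theory Num.Theory.
Import numFieldNormedType.Exports.

Local Open Scope classical_set_scope.
Local Open Scope ring_scope.
Local Open Scope ereal_scope.

Record category : Type := Category {
  obj :> Type;
  hom : obj -> obj -> Type;
  id_arrow : forall x, hom x x;
  comp_arrow : forall x y z, hom y z -> hom x y -> hom x z;
  comp_id_l : forall x y (f : hom x y), comp_arrow (id_arrow y) f = f;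
  comp_id_r : forall x y (f : hom x y), comp_arrow f (id_arrow x) = f;
  comp_assoc : forall x y z t (h : hom z t) (g : hom y z) (f : hom x y),
    comp_arrow h (comp_arrow g f) = comp_arrow (comp_arrow h g) f }.

Arguments hom {c} x y.
Arguments id_arrow {c} x.
Arguments comp_arrow {c x y z} g f.

Notation "g ∘ f" := (comp_arrow g f) (at level 40, left associativity).

Definition cast_cod (X : category) (x y z : X) (e : y = z) (f : hom x y) :
  hom x z := eq_rect y (fun t => hom x t) f z e.

Definition cast_dom (X : category) (x y z : X) (e : x = y) (f : hom x z) :
  hom y z := eq_rect x (fun t => hom t z) f y e.

(* Equality of arrows does not make sense across different hom types, so being
   an identity arrow includes the equality of source and target. *)
Definition is_identity (X : category) (x y : X) (f : hom x y) : Prop :=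
  exists e : x = y, f = cast_cod e (id_arrow x).

Record functor (X Y : category) : Type := Functor {
  fobj :> X -> Y;
  fmap : forall x y, hom x y -> hom (fobj x) (fobj y);
  fmap_id : forall x, fmap (id_arrow x) = id_arrow (fobj x);
  fmap_comp : forall x y z (g : hom y z) (f : hom x y),
    fmap (g ∘ f) = fmap g ∘ fmap f }.

Arguments fmap {X Y} F {x y} f : rename.

(* In \bar R the difference +oo - +oo is -oo, of absolute value +oo, hence the
   explicit guard on the lower bound when both weights are infinite.  In all
   other cases the arithmetic of \bar R agrees with r + oo = |r - oo| = oo. *)
Record metric1space (R : realType) : Type := Metric1Space {
  cat_of :> category;
  weight : forall x y : cat_of, hom x y -> \bar R;
  weight_ge0 : forall (x y : cat_of) (f : hom x y), 0 <= weight f;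
  weight_id : forall x : cat_of, weight (id_arrow x) = 0;
  weight_triangle : forall (x y z : cat_of) (g : hom y z) (f : hom x y),
    weight (g ∘ f) <= weight g + weight f;
  weight_triangle_lower :
    forall (x y z : cat_of) (g : hom y z) (f : hom x y),
    ~ (weight g = +oo /\ weight f = +oo) ->
    `|weight g - weight f| <= weight (g ∘ f) }.

Arguments weight {R X x y} f : rename.

Section Metric1Space.
Variable R : realType.

Definition non_degenerate (X : metric1space R) : Prop :=
  forall (x y : X) (f : hom x y), weight f = 0 -> is_identity f.

Section Series.
Variable X : metric1space R.

Section Forward.
Variables (x : nat -> X) (psi : forall n, hom (x n) (x n.+1)).

(* forward_comp m k = psi_(k+m) ∘ ... ∘ psi_m *)
Fixpoint forward_comp (m k : nat) : hom (x m) (x (k + m).+1) :=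
  if k is k'.+1 then psi (k'.+1 + m) ∘ forward_comp m k' else psi m.

Definition forward_converges : Prop :=
  exists (xoo : X) (mu : forall n, hom (x n) xoo),
    (forall n, mu n.+1 ∘ psi n = mu n) /\
    weight (mu n) @[n --> \oo] --> (0 : \bar R).

Definition forward_cauchy : Prop :=
  forall eps : R, (0 < eps)%R -> exists N : nat, forall n m : nat,
    (N < m)%N -> (m < n)%N -> weight (forward_comp m (n - m)) < eps%:E.

End Forward.

Section Backward.
Variables (x : nat -> X) (psi : forall n, hom (x n.+1) (x n)).

(* backward_comp m k = psi_m ∘ ... ∘ psi_(k+m) *)
Fixpoint backward_comp (m k : nat) : hom (x (k + m).+1) (x m) :=
  if k is k'.+1 then backward_comp m k' ∘ psi (k'.+1 + m) else psi m.

Definition backward_converges : Prop :=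
  exists (xoo : X) (mu : forall n, hom xoo (x n)),
    (forall n, psi n ∘ mu n.+1 = mu n) /\
    weight (mu n) @[n --> \oo] --> (0 : \bar R).

Definition backward_cauchy : Prop :=
  forall eps : R, (0 < eps)%R -> exists N : nat, forall n m : nat,
    (N < m)%N -> (m < n)%N -> weight (backward_comp m (n - m)) < eps%:E.

End Backward.

Definition forward_complete : Prop :=
  forall (x : nat -> X) (psi : forall n, hom (x n) (x n.+1)),
    forward_cauchy psi -> forward_converges psi.

Definition backward_complete : Prop :=
  forall (x : nat -> X) (psi : forall n, hom (x n.+1) (x n)),
    backward_cauchy psi -> backward_converges psi.

End Series.

Definition forward_continuous (X Y : metric1space R) (F : functor X Y) : Prop :=
  forall (x z : X) (psi : hom x z) (eps : R), (0 < eps)%R ->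
    exists2 delta : R, (0 < delta)%R &
      forall (y : X) (tau : hom x y) (rho : hom y z),
        psi = rho ∘ tau -> weight rho < delta%:E ->
        weight (fmap F rho) < eps%:E.

Definition backward_continuous (X Y : metric1space R) (F : functor X Y) : Prop :=
  forall (x z : X) (psi : hom x z) (eps : R), (0 < eps)%R ->
    exists2 delta : R, (0 < delta)%R &
      forall (y : X) (tau : hom x y) (rho : hom y z),
        psi = rho ∘ tau -> weight tau < delta%:E ->
        weight (fmap F tau) < eps%:E.

(* The convention 0 * +oo = 0 of \bar R is immaterial: a functor satisfying the
   bound with kappa = 0 under the convention 0 * +oo = +oo satisfies it with
   any kappa > 0. *)
Definition contraction (X : metric1space R) (F : functor X X) : Prop :=
  exists kappa : R, (0 <= kappa < 1)%R /\
    forall (x y : X) (psi : hom x y),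
      weight (fmap F psi) <= kappa%:E * weight psi.

End Metric1Space.

Record forward_natural_contraction (X : category) (F : functor X X) : Type :=
  ForwardNaturalContraction {
    fnc :> forall c : X, hom c (F c);
    fnc_natural : forall (c d : X) (f : hom c d), fmap F f ∘ fnc c = fnc d ∘ f;
    fnc_fmap : forall c : X, fmap F (fnc c) = fnc (F c) }.

Record backward_natural_contraction (X : category) (F : functor X X) : Type :=
  BackwardNaturalContraction {
    bnc :> forall c : X, hom (F c) c;
    bnc_natural : forall (c d : X) (f : hom c d), f ∘ bnc c = bnc d ∘ fmap F f;
    bnc_fmap : forall c : X, fmap F (bnc c) = bnc (F c) }.

Definition forward_fixed (X : category) (F : functor X X)
    (alpha : forward_natural_contraction F) (c d : X) (psi : hom c d) : Prop :=
  exists e : F d = d, cast_cod e (fmap F psi ∘ alpha c) = psi.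

Definition backward_fixed (X : category) (F : functor X X)
    (alpha : backward_natural_contraction F) (c d : X) (psi : hom d c) : Prop :=
  exists e : F d = d, cast_dom e (alpha c ∘ fmap F psi) = psi.

(* Main.v *)
From mathcomp Require Import all_boot order ssralg ssrnum reals ereal.
From mathcomp Require Import classical_sets topology normedtype sequences ring.
Require Import Defs.

Set Implicit Arguments.
Unset Strict Implicit.
Unset Printing Implicit Defensive.

Import Order.TTheory GRing.Theory Num.Theory.
Import numFieldNormedType.Exports.

Local Open Scope ereal_scope.

(** Let [c] be an object with [w(alpha_c)] finite. Since
    [F^n(alpha_c) = alpha_(F^n c)], the arrows [alpha_(F^n c)] form a series of
    geometrically decaying weights starting at [c]; let [mu_n : F^n c -> d] be
    its limit. Naturality gives
    [F(mu_n) ∘ alpha_(F^n c) = alpha_d ∘ mu_n], and every arrow here other than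
    [alpha_d] has weight tending to [0]; by the lower triangle inequality
    [w(alpha_d) = 0], so [alpha_d] is an identity, [F d = d], and every arrow
    into [d], such as [mu_0], is fixed. The backward case is the forward case
    in the opposite category. *)

(** The lower triangle inequality solved for [weight g]. Finiteness of [weight f] permits the
    subtraction and rules out two infinite weights. *)
Lemma weight_le_comp_add (R : realType) (X : metric1space R) (x y z : X)
    (g : hom y z) (f : hom x y) :
  weight f < +oo -> weight g <= weight (g ∘ f) + weight f.
Proof.
move=> f_lty.
have f_fin : weight f \is a fin_num by rewrite ge0_fin_numE ?weight_ge0.
rewrite -leeBlDr //; apply: (le_trans (lee_abs _)).
by apply: weight_triangle_lower => -[_ fE]; rewrite fE ltxx in f_lty.
Qed.

(** The bound is the closed form of [w k^m + ... + w k^(j+m)]; as a telescoping difference it makes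
    the induction step a field identity. *)
Lemma weight_forward_comp_geometric (R : realType) (X : metric1space R)
    (x : nat -> X) (psi : forall n, hom (x n) (x n.+1)) (w k : R) :
  (k < 1)%R -> (forall n, weight (psi n) <= (w * k ^+ n)%:E) ->
  forall m j,
    weight (forward_comp psi m j) <= (w / (1 - k) * (k ^+ m - k ^+ (j + m).+1))%:E.
Proof.
move=> k1 psi_le m; have k1' : (1 - k != 0)%R by rewrite subr_eq0 gt_eqF.
elim=> [|j IH] /=.
  apply: (le_trans (psi_le m)); rewrite lee_fin add0n exprS le_eqVlt.
  by apply/orP; left; apply/eqP; field.
apply: (le_trans (weight_triangle _ _)); apply: (le_trans (leeD (psi_le _) IH)).
rewrite -EFinD lee_fin addSn [(k ^+ (j + m).+2)%R]exprS le_eqVlt.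
by apply/orP; left; apply/eqP; field.
Qed.

Lemma geometric_forward_cauchy (R : realType) (X : metric1space R)
    (x : nat -> X) (psi : forall n, hom (x n) (x n.+1)) (w k : R) :
  (0 <= k < 1)%R -> (forall n, weight (psi n) <= (w * k ^+ n)%:E) ->
  forward_cauchy psi.
Proof.
move=> /andP[k0 k1] psi_le eps eps0.
have w0 : (0 <= w)%R.
  by have := le_trans (weight_ge0 _) (psi_le 0%N); rewrite lee_fin expr0 mulr1.
have : (geometric (w / (1 - k)) k @ \oo --> (0 : R)%R)%classic.
  by apply: cvg_geometric; rewrite ger0_norm.
move=> /cvgr_lt /(_ _ eps0) [N _ HN]; exists N => n m Nm _.
apply: (le_lt_trans (weight_forward_comp_geometric k1 psi_le _ _)).
rewrite lte_fin; apply: le_lt_trans (HN m (ltnW Nm)).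
rewrite /geometric /= ler_wpM2l ?divr_ge0 ?subr_ge0 ?(ltW k1) //.
by rewrite gerBl exprn_ge0.
Qed.

(** [alpha] at the next iterate is the [F]-image of [alpha] at the current one, so each step gains a
    factor [k]. *)
Lemma weight_iter_geometric (R : realType) (X : metric1space R)
    (F : functor X X) (alpha : forward_natural_contraction F) (k w : R) (c : X) :
  (0 <= k)%R ->
  (forall (x y : X) (f : hom x y), weight (fmap F f) <= k%:E * weight f) ->
  weight (alpha c) <= w%:E ->
  forall n, weight (alpha (iter n F c)) <= (w * k ^+ n)%:E.
Proof.
move=> k0 F_le c_le; elim=> [|n IH]; first by rewrite expr0 mulr1.
rewrite iterS -fnc_fmap; apply: (le_trans (F_le _ _ _)).
apply: (le_trans (lee_wpmul2l _ IH)); first by rewrite lee_fin.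
by rewrite -EFinM lee_fin exprS mulrCA.
Qed.

Lemma forward_fixed_of_identity (X : category) (F : functor X X)
    (alpha : forward_natural_contraction F) (c d : X) (psi : hom c d) :
  is_identity (alpha d) -> forward_fixed alpha psi.
Proof.
move=> [e alpha_d]; exists (esym e); rewrite fnc_natural alpha_d.
by case: _ / e {alpha_d} => /=; rewrite comp_id_l.
Qed.

Lemma forward_fixed_exists (R : realType) (X : metric1space R)
    (F : functor X X) (alpha : forward_natural_contraction F) :
  forward_complete X -> non_degenerate X -> contraction F ->
  (exists c : X, weight (alpha c) < +oo) ->
  exists (c d : X) (psi : hom c d), forward_fixed alpha psi.
Proof.
move=> complX nondegX [k [/andP[k0 k1] F_le]] [c c_lty].
have c_fin : weight (alpha c) \is a fin_num by rewrite ge0_fin_numE ?weight_ge0.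
have c_le : weight (alpha c) <= (fine (weight (alpha c)))%:E by rewrite fineK.
have alpha_le := weight_iter_geometric k0 F_le c_le.
move: (fine _) alpha_le => w alpha_le {c_fin c_le}.
have [|d [mu [_ mu0]]] := complX (fun n => iter n F c) (fun n => alpha (iter n F c)).
  by apply: geometric_forward_cauchy alpha_le; rewrite k0.
exists c, d, (mu 0%N); apply: forward_fixed_of_identity; apply: nondegX.
apply/eqP; rewrite eq_le weight_ge0 andbT; apply/lee_addgt0Pr => eps eps0.
(* One third each for [fmap F (mu n)], [alpha (iter n F c)] and [mu n]. *)
rewrite add0e; have eps3 : (0 < eps / 3)%R by rewrite divr_gt0.
have : (geometric w k @ \oo --> (0 : R)%R)%classic.
  by apply: cvg_geometric; rewrite ger0_norm.
move=> /cvgr_lt /(_ _ eps3) [N1 _ HN1].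
have [N2 _ HN2] : (\forall n \near \oo, weight (mu n) < (eps / 3)%:E)%classic.
  have : nbhs (0 : \bar R) [set y | y < (eps / 3)%:E]%classic.
    by apply: open_nbhs_nbhs; split; [exact: open_ereal_lt_ereal|rewrite /= lte_fin].
  exact: mu0.
pose n := maxn N1 N2.
have mu_lt : weight (mu n) < (eps / 3)%:E by apply: HN2; rewrite /= leq_maxr.
have w_lt : (w * k ^+ n < eps / 3)%R by apply: HN1; rewrite /= leq_maxl.
apply: (le_trans (weight_le_comp_add _ (lt_trans mu_lt (ltry _)))).
rewrite -fnc_natural (_ : eps = eps / 3 + eps / 3 + eps / 3)%R; last by field.
rewrite !EFinD; apply: leeD (ltW mu_lt).
apply: (le_trans (weight_triangle _ _)); apply: leeD.
  (* Since [k < 1], [F] does not increase the weight of [mu n]. *)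
  apply: (le_trans (F_le _ _ _)); apply: le_trans (ltW mu_lt).
  by rewrite gee_pMl ?weight_ge0 ?lee_fin ?(ltW k1).
by apply: (le_trans (alpha_le n)); rewrite lee_fin ltW.
Qed.

(** Reversing arrows swaps the two weights in the lower triangle inequality. *)
Lemma abse_distC (R : realDomainType) (a b : \bar R) : `|a - b| = `|b - a|.
Proof. by case: a b => [a| |] [b| |] //=; rewrite distrC. Qed.

Definition op_category (X : category) : category :=
  @Category X (fun x y => @hom X y x) (@id_arrow X)
    (fun x y z g f => f ∘ g)
    (fun x y f => comp_id_r f) (fun x y f => comp_id_l f)
    (fun x y z t h g f => esym (comp_assoc f g h)).

Section OppositeSpace.
Variables (R : realType) (X : metric1space R).

Let op_weight (x y : op_category X) (f : hom x y) : \bar R := @weight R X y x f.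

Lemma op_weight_triangle (x y z : op_category X) (g : hom y z) (f : hom x y) :
  op_weight (g ∘ f) <= op_weight g + op_weight f.
Proof. by rewrite addeC; exact: weight_triangle. Qed.

Lemma op_weight_triangle_lower (x y z : op_category X)
    (g : hom y z) (f : hom x y) :
  ~ (op_weight g = +oo /\ op_weight f = +oo) ->
  `|op_weight g - op_weight f| <= op_weight (g ∘ f).
Proof.
move=> gf; rewrite abse_distC; apply: weight_triangle_lower => -[fy gy].
exact: gf.
Qed.

Definition op_space : metric1space R :=
  @Metric1Space R (op_category X) op_weight
    (fun x y f => weight_ge0 f) (fun x => weight_id x)
    op_weight_triangle op_weight_triangle_lower.

Lemma forward_comp_op (x : nat -> X) (psi : forall n, hom (x n.+1) (x n)) m j :
  @forward_comp R op_space x psi m j = backward_comp psi m j.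
Proof. by elim: j => //= j ->. Qed.

Lemma forward_complete_op : backward_complete X -> forward_complete op_space.
Proof.
move=> complX x psi psiC; apply: (complX x psi) => eps /psiC[N HN].
by exists N => n m Nm mn; rewrite -forward_comp_op; exact: HN.
Qed.

(** Duality reverses the equality of source and target inside [is_identity]; once it is eliminated,
    both sides are the same identity arrow. *)
Lemma non_degenerate_op : non_degenerate X -> non_degenerate op_space.
Proof.
by move=> nondegX x y f /nondegX[e ->]; case: _ / e; exists erefl.
Qed.

End OppositeSpace.

Definition op_functor (X : category) (F : functor X X) :
    functor (op_category X) (op_category X) :=
  @Functor (op_category X) (op_category X) F (fun x y f => @fmap X X F y x f)
    (fmap_id F) (fun x y z g f => fmap_comp F f g).

Definition op_natural_contraction (X : category) (F : functor X X)
    (alpha : backward_natural_contraction F) :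
    forward_natural_contraction (op_functor F) :=
  @ForwardNaturalContraction (op_category X) (op_functor F) alpha
    (fun c d f => esym (bnc_natural alpha f)) (bnc_fmap alpha).

(** Some [alpha c] must have finite weight: on the ordered set of integers, with weight [+oo] on all
    non-identity arrows, the successor functor meets the other forward assumptions but fixes no
    object. *)
Theorem theorem7p17 (R : realType) (X : metric1space R) (F : functor X X) :
  (forward_complete X -> non_degenerate X ->
   forward_continuous F -> contraction F ->
   forall alpha : forward_natural_contraction F,
   (exists c : X, weight (alpha c) < +oo) ->
   (exists (c d : X) (psi : hom c d), forward_fixed alpha psi) /\
   (exists d : X, F d = d))
  /\
  (backward_complete X -> non_degenerate X ->
   backward_continuous F -> contraction F ->
   forall alpha : backward_natural_contraction F,
   (exists c : X, weight (alpha c) < +oo) ->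
   (exists (c d : X) (psi : hom d c), backward_fixed alpha psi) /\
   (exists d : X, F d = d)).
Proof.
split=> complX nondegX _ Fk alpha alpha_fin.
  have [c [d [psi fix_psi]]] := forward_fixed_exists complX nondegX Fk alpha_fin.
  by split; [exists c, d, psi | case: fix_psi => e _; exists d].
have Fk_op : @contraction R (op_space X) (op_functor F).
  by case: Fk => k [k01 F_le]; exists k; split=> // x y f; exact: F_le.
have [c [d [psi fix_psi]]] := @forward_fixed_exists R (op_space X) _
  (op_natural_contraction alpha) (forward_complete_op complX)
  (non_degenerate_op nondegX) Fk_op alpha_fin.
(* [cast_dom] in [X] is convertible to [cast_cod] in [op_category X]. *)
by split; [exists c, d, psi | case: fix_psi => e _; exists d].
Qed.
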